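(* Let $T_{q_0}$, with $T=\langle X_n,Q,\pi,\lambda\rangle$, be an initial one-way synchronizing transducer representing a homeomorphism of $\mathfrak{C}_n$, with inverse $S_{(\epsilon,q_0)}$, $S=\langle X_n,Q',\pi',\lambda'\rangle$. Let $A=\langle X_n,Q',\pi',(\epsilon,q_0)\rangle$ be the automaton (with start state $(\epsilon,q_0)$) obtained from $S$ by forgetting outputs. Then $V_n^{T_{q_0}}=V_{\sim_A}$, where $V_n^{T_{q_0}}=T_{q_0}^{-1}V_nT_{q_0}$.
   Context: Words. $n\ge 2$, $X_n=\{0,\dots,n-1\}$; $X_n^*$ is the set of finite words over $X_n$, $\epsilon$ the empty word, $X_n^+=X_n^*\setminus\{\epsilon\}$, $X_n^k$ the set of words of length $k$; $\mathfrak{C}_n=X_n^\omega$ is Cantor space; for $\alpha\in X_n^*$ the cone $[\alpha]$ is the set of elements of $\mathfrak{C}_n$ with prefix $\alpha$. If $u$ is a prefix of $v$, $v-u$ denotes the word $\mu$ with $v=u\mu$. Functions are written to the right of their arguments and composed left to right; $h^g=g^{-1}hg$. Transducers. A transducer $T=\langle X_n,Q,\pi,\lambda\rangle$ consists of a finite state set $Q$ and functions $\pi:X_n\times Q\to Q$ (transition), $\lambda:X_n\times Q\to X_n^*$ (output), extended to words by $\pi(\epsilon,q)=q$, $\lambda(\epsilon,q)=\epsilon$, $\pi(xw,q)=\pi(w,\pi(x,q))$, $\lambda(xw,q)=\lambda(x,q)\lambda(w,\pi(x,q))$ (and $\lambda$ likewise to infinite words). For a state $q$, the initial transducer $T_q$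 is $T$ started at $q$; it is identified with the map $\mathfrak{C}_n\to\mathfrak{C}_n$, $\delta\mapsto\lambda(\delta,q)$ (outputs on infinite words being infinite). Inverse. Suppose $T_{q_0}$ is a homeomorphism and every state of $T$ is accessible from $q_0$ (i.e. equals $\pi(w,q_0)$ for some $w\in X_n^*$). For a state $q$ and $\alpha\in X_n^*$ let $\mathcal{L}_q(\alpha)$ be the longest common prefix of all words in the preimage of $[\alpha]$ under $T_q$. The inverse $S_{(\epsilon,q_0)}$ of $T_{q_0}$ has initial state $(\epsilon,q_0)$; its states are the pairs $(w,q)\in X_n^*\times Q$ accessible from $(\epsilon,q_0)$ under, for $x\in X_n$, $\lambda'(x,(w,q))=\mathcal{L}_q(wx)$ and $\pi'(x,(w,q))=\big(wx-\lambda(\mathcal{L}_q(wx),q),\ \pi(\mathcal{L}_q(wx),q)\big)$. There are finitely many such states, and $S_{(\epsilon,q_0)}$ induces the homeomorphism $T_{q_0}^{-1}$. Synchronization. $T$ is synchronizing at level $k$ if there is $f:X_n^k\to Q$ with $\pi(\alpha,q)=f(\alpha)$ for all $\alpha\in X_n^k$, $q\in Q$; it is synchronizing if it is so at some level. It is one-way synchronizing if it is synchronizing but its inverse $S$ is not. $V_n$ is the generalised Thompson group $G_{n,1}$: the homeomorphisms $v$ of $\mathfrak{C}_n$ for which there are maximal antichains $\{\alpha_1,\dots,\alpha_l\}$, $\{\beta_1,\dots,\beta_l\}$ of $X_n^*$ (in the prefix order, i.e. the cones partition $\mathfrak{C}_n$) with $(\alpha_i\chi)v=\beta_i\chi$ for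 all $i$ and all $\chi\in\mathfrak{C}_n$. The relation $\sim_A$. Let $A=\langle X_n,Q_A,\pi_A,a_0\rangle$ be a finite automaton with transition function $\pi_A:X_n\times Q_A\to Q_A$ (extended to words) and start state $a_0$. One step of the collapsing procedure replaces $A$ by the automaton whose states are the classes of the equivalence relation ''$q_1\sim q_2$ iff $\pi_A(i,q_1)=\pi_A(i,q_2)$ for all $i\in X_n$'', with start state $[a_0]$ and transitions $(i,[q])\mapsto[\pi_A(i,q)]$. Repeat until obtaining an automaton $A_k$ in which distinct states $q\ne q'$ have distinct tuples $(\pi(0,q),\dots,\pi(n-1,q))\neq(\pi(0,q'),\dots,\pi(n-1,q'))$. For $\alpha,\beta\in X_n^+$ define $\alpha\sim_A\beta$ iff $\pi_A(\alpha,a_0)$ and $\pi_A(\beta,a_0)$ represent the same state of $A_k$. The group $V_\sim$. For an equivalence relation $\sim$ on $X_n^+$, an element $v\in V_n$ preserves $\sim$ if whenever $\alpha,\beta\in X_n^+$ satisfy $(\alpha\chi)v=\beta\chi$ for all $\chi\in\mathfrak{C}_n$, then $\alpha\sim\beta$. $V_\sim$ is the subgroup of $V_n$ generated by the elements preserving $\sim$. *)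

(* Defs.v *)
From HB Require Import structures.
From mathcomp Require Import all_boot generic_quotient.
From mathcomp Require Import boolp classical_sets functions topology.

Set Implicit Arguments.
Unset Strict Implicit.
Unset Printing Implicit Defensive.

Local Open Scope classical_set_scope.
Local Open Scope quotient_scope.

Notation word n := (seq 'I_n).

Definition cantor (n : nat) : Type :=
  prod_topology (fun _ : nat => discrete_topology 'I_n).

HB.instance Definition _ n := Choice.on (cantor n).
HB.instance Definition _ n := Nbhs.on (cantor n).
HB.instance Definition _ n := Topological.on (cantor n).

(* [mkseq d k] is the prefix of length [k] of the infinite word [d]. *)
Definition cone n (u : word n) : set (cantor n) :=
  [set d | u = mkseq d (size u)].

(* The default [c 0] of [nth] is never reached. *)
Definition wcat n (u : word n) (c : cantor n) : cantor n :=
  fun i => if i < size u then nth (c 0) u i else c (i - size u).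

(* [wminus v u] is v - u; it is only meaningful when [u] is a prefix of [v]. *)
Definition wminus n (v u : word n) : word n := drop (size u) v.

(* The longest common prefix of the infinite words in [P]; it exists as soon as
   [P] has at least two elements, and the junk value is the empty word. *)
Definition lcp n (P : set (cantor n)) : word n :=
  xget [::] [set u | P `<=` cone u /\
    forall v : word n, P `<=` cone v -> size v <= size u].

Definition homeomorphism (X : topologicalType) (f : X -> X) : Prop :=
  continuous f /\ exists g, [/\ cancel f g, cancel g f & continuous g].

Record transducer (n : nat) (Q : Type) := Transducer {
  trans : 'I_n -> Q -> Q;
  output : 'I_n -> Q -> word n }.

Fixpoint transw n Q (T : transducer n Q) (w : word n) (q : Q) : Q :=
  if w is x :: w' then transw T w' (trans T x q) else q.

Fixpoint outputw n Q (T : transducer n Q) (w : word n) (q : Q) : word n :=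
  if w is x :: w' then output T x q ++ outputw T w' (trans T x q) else [::].

Definition infinite_outputs n Q (T : transducer n Q) : Prop :=
  forall (q : Q) (d : cantor n) (k : nat),
    exists m, k <= size (outputw T (mkseq d m) q).

(* The map induced by T started at q: the image of [d] is the infinite word all
   of whose finite approximations are the outputs on the prefixes of [d]. It is
   unique when outputs are infinite; otherwise the value may be junk. *)
Definition tmap n Q (T : transducer n Q) (q : Q) (d : cantor n) : cantor n :=
  xget d [set e | forall m, cone (outputw T (mkseq d m) q) e].

Definition accessible n Q (T : transducer n Q) (q0 : Q) : set Q :=
  [set q | exists w : word n, transw T w q0 = q].

Definition synchronizing_at n Q (T : transducer n Q) (k : nat) : Prop :=
  exists f : k.-tuple 'I_n -> Q,
    forall (a : k.-tuple 'I_n) (q : Q), transw T a q = f a.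

Definition synchronizing n Q (T : transducer n Q) : Prop :=
  exists k, synchronizing_at T k.

Lemma accessible_trans n Q (T : transducer n Q) (q0 : Q) (x : 'I_n) (q : Q) :
  accessible T q0 q -> accessible T q0 (trans T x q).
Proof.
move=> [w <-]; exists (rcons w x).
by elim: w q0 => //= y w IH q0; exact: IH.
Qed.

Definition restrict_accessible n (Q : Type) (T : transducer n Q) (q0 : Q) :
    transducer n (accessible T q0) :=
  @Transducer n (accessible T q0)
    (fun x p => exist _ (trans T x (val p))
       (mem_set (accessible_trans x (set_mem (valP p)))))
    (fun x p => output T x (val p)).

Lemma accessible_start n Q (T : transducer n Q) (q0 : Q) : accessible T q0 q0.
Proof. by exists [::]. Qed.

Definition accessible0 n Q (T : transducer n Q) (q0 : Q) : accessible T q0 :=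
  exist _ q0 (mem_set (accessible_start T q0)).

Definition lpre n Q (T : transducer n Q) (q : Q) (a : word n) : word n :=
  lcp (tmap T q @^-1` cone a).

(* The transitions and outputs of the inverse, on all of X_n^* x Q. *)
Definition inverse_pairs n Q (T : transducer n Q) : transducer n (word n * Q) :=
  @Transducer n (word n * Q)
    (fun x p => let L := lpre T p.2 (rcons p.1 x) in
       (wminus (rcons p.1 x) (outputw T L p.2), transw T L p.2))
    (fun x p => lpre T p.2 (rcons p.1 x)).

Definition inverse_state n Q (T : transducer n Q) (q0 : Q) :
    set (word n * Q) :=
  accessible (inverse_pairs T) ([::], q0).

Definition inverse n Q (T : transducer n Q) (q0 : Q) :
    transducer n (inverse_state T q0) :=
  restrict_accessible (inverse_pairs T) ([::], q0).

Definition inverse0 n Q (T : transducer n Q) (q0 : Q) : inverse_state T q0 :=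
  accessible0 (inverse_pairs T) ([::], q0).

Definition one_way_synchronizing n Q (T : transducer n Q) (q0 : Q) : Prop :=
  synchronizing T /\ ~ synchronizing (inverse T q0).

Record automaton (n : nat) := Automaton {
  astate :> choiceType;
  atrans : 'I_n -> astate -> astate;
  astart : astate }.

Definition automaton_of n (Q : choiceType) (T : transducer n Q) (q0 : Q) :
    automaton n :=
  Automaton (trans T) q0.

Fixpoint atransw n (A : automaton n) (w : word n) (q : A) : A :=
  if w is x :: w' then atransw w' (atrans x q) else q.

Section Collapse.
Variables (n : nat) (A : automaton n).

Definition collapse_rel : rel A :=
  fun q1 q2 => [forall i : 'I_n, atrans i q1 == atrans i q2].

Lemma collapse_rel_refl : reflexive collapse_rel.
Proof. by move=> q; apply/forallP. Qed.

Lemma collapse_rel_sym : symmetric collapse_rel.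
Proof. by move=> q1 q2; apply: eq_forallb => i; rewrite eq_sym. Qed.

Lemma collapse_rel_trans : transitive collapse_rel.
Proof.
move=> q2 q1 q3 /forallP h12 /forallP h23; apply/forallP => i.
by rewrite (eqP (h12 i)) h23.
Qed.

Canonical collapse_equiv :=
  EquivRel collapse_rel collapse_rel_refl collapse_rel_sym collapse_rel_trans.

(* By [atrans_collapse_class] below, the transition does not depend on the
   representative [repr c] of the class [c]. *)
Definition collapse : automaton n :=
  @Automaton n {eq_quot collapse_equiv}
    (fun i c => \pi_({eq_quot collapse_equiv}) (atrans i (repr c)))
    (\pi_({eq_quot collapse_equiv}) (astart A)).

Definition collapse_class (q : A) : collapse := \pi_({eq_quot collapse_equiv}) q.

Lemma atrans_collapse_class (i : 'I_n) (q : A) :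
  atrans i (collapse_class q) = collapse_class (atrans i q).
Proof.
have /eqmodP /forallP /(_ i) /eqP qi :
  repr (collapse_class q) = q %[mod {eq_quot collapse_equiv}] by rewrite reprK.
by rewrite /= qi.
Qed.

Definition collapsed : Prop :=
  forall q1 q2 : A, (forall i : 'I_n, atrans i q1 = atrans i q2) -> q1 = q2.

End Collapse.

Fixpoint represented n (A : automaton n) (k : nat) (q : A) :
    iter k (@collapse n) A :=
  if k is k'.+1 then collapse_class (represented k' q) else q.

(* When [A] is finite there is [k] such that [iter k collapse A] is collapsed;
   the relation does not depend on which such [k] is used, since collapsing a
   collapsed automaton identifies no states. It is meant for non-empty words. *)
Definition sim n (A : automaton n) (a b : word n) : Prop :=
  exists k, collapsed (iter k (@collapse n) A) /\
    represented k (atransw a (astart A)) = represented k (atransw b (astart A)).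

Definition maximal_antichain n (s : seq (word n)) : Prop :=
  [/\ uniq s,
      {in s &, forall a b, prefix a b -> a = b} &
      forall w : word n, exists2 a, a \in s & prefix a w || prefix w a].

Definition thompson n : set (cantor n -> cantor n) :=
  [set v | homeomorphism v /\
    exists (l : nat) (a b : l.-tuple (word n)),
      [/\ maximal_antichain a, maximal_antichain b &
          forall (i : 'I_l) (c : cantor n),
            v (wcat (tnth a i) c) = wcat (tnth b i) c]].

(* Maps act on the right on paper: the product f g there is [g \o f] here. *)
Definition subgroup (X : topologicalType) (G : set (X -> X)) : Prop :=
  [/\ G `<=` [set f | homeomorphism f], G idfun,
      forall f g, G f -> G g -> G (g \o f) &
      forall f g, G f -> cancel f g -> cancel g f -> G g].

Definition preserves n (R : word n -> word n -> Prop)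
    (v : cantor n -> cantor n) : Prop :=
  forall a b : word n, a != [::] -> b != [::] ->
    (forall c : cantor n, v (wcat a c) = wcat b c) -> R a b.

Definition thompson_sim n (R : word n -> word n -> Prop) :
    set (cantor n -> cantor n) :=
  smallest (@subgroup (cantor n)) [set v | thompson v /\ preserves R v].

(* [conjugate t G] is t^-1 G t in right-action notation. *)
Definition conjugate (X : Type) (t : X -> X) (G : set (X -> X)) :
    set (X -> X) :=
  [set f | exists v t', [/\ G v, cancel t t', cancel t' t & f = t \o v \o t']].

(* Main.v *)
Require Import Defs.
From mathcomp Require Import all_boot generic_quotient.
From mathcomp Require Import boolp classical_sets functions topology.

(** Write [h] for the homeomorphism induced by [T] started at [q0], [lambda] for
    its output, and [L a] for the longest common prefix of the preimage under
    [h] of the cone of [a].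

    After reading [a], the inverse transducer is in the state [(w, q)] where
    [q] is the state of [T] after [L a] and [w] is what remains of [a] once
    [lambda (L a)] is removed ([state_lpre]). These states describe how the
    inverse of [h] acts below [a]: it sends [a c] to [L a y], where [y] is the
    solution of [T_q y = w c] ([output_split]). There are finitely many of them
    ([states_finite]), because the inverse of [h] is uniformly continuous.
    Collapsing [k] times identifies two states exactly when every word of length
    [k] leads them to the same state ([represented_eq]); hence [a] and [b] are
    equivalent iff [a t] and [b t] lead to the same state for all words [t] of
    some fixed length ([sim_iff_states]).

    By compactness, a homeomorphism belongs to the Thompson group iff it acts by
    prefix replacement on every cone of some fixed depth ([thompsonP]).

    Let [v] be in the Thompson group and let [f] be its conjugate by [h]. On a
    deep cone [a], the word [L a] can be cut as [al ++ ga] where [v] replaces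
    the prefix [al] by some [be] and [ga] is long enough to synchronize [T].
    Reading [al ++ ga] and [be ++ ga] leaves [T] in the same state, so [f] acts
    by prefix replacement on [a], and if [f] replaces [a] by [b] then
    [L b = be ++ ga] and the states of the inverse after [a] and [b] are equal.
    Hence [f] is itself an element of the Thompson group that preserves the
    relation ([conjugate_in_sim]).

    Conversely, if [v] is in the Thompson group and preserves the relation, then
    on all cones [a] of some fixed depth it replaces [a] by a word [b] with the
    same state. The conjugate of [v] by the inverse of [h] then replaces [L a]
    by [L b] ([sim_in_conjugate]), so it is in the Thompson group. As the
    conjugate of the Thompson group is a group, it contains the group generated
    by these [v]. *)

Set Implicit Arguments.
Unset Strict Implicit.
Unset Printing Implicit Defensive.
Local Open Scope classical_set_scope.

(** * Words, cones and the topology of Cantor space *)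

Section Words.
Variable n : nat.
Implicit Types (u v w : word n) (c d e : cantor n).

Lemma cone_wcat u c : cone u (wcat u c).
Proof.
rewrite /cone /=; apply: (@eq_from_nth _ (c 0)); rewrite ?size_mkseq //.
by move=> i ilt; rewrite nth_mkseq // /wcat ilt.
Qed.

Lemma cone_wcatE u d : cone u d -> d = wcat u (fun i => d (size u + i)).
Proof.
move=> ud; apply/funext => i; rewrite /wcat; case: ltnP => ilt.
  by rewrite [in RHS]ud nth_mkseq.
by rewrite subnKC.
Qed.

Lemma cone_ex u d : cone u d -> exists c, d = wcat u c.
Proof. by move=> /cone_wcatE ->; eexists. Qed.

Lemma wcat_cat u v c : wcat (u ++ v) c = wcat u (wcat v c).
Proof.
apply/funext => i; rewrite /wcat size_cat nth_cat.
case: (ltnP i (size u)) => iu.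
  by rewrite ltn_addr //; apply: set_nth_default.
by rewrite ltn_subLR // subnDA.
Qed.

Lemma wcat_inj u : injective (wcat u).
Proof.
move=> c d cd; apply/funext => i.
move: (congr1 (fun f : cantor n => f (size u + i)) cd); rewrite /wcat.
by rewrite ltnNge leq_addr /= addKn.
Qed.

Lemma mkseq_wcat_size u c : mkseq (wcat u c) (size u) = u.
Proof. exact/esym/cone_wcat. Qed.

Lemma wcat_eq_prefix u v c d :
  size u <= size v -> wcat u c = wcat v d -> prefix u v.
Proof.
move=> suv E; apply/prefixP; exists (drop (size u) v).
rewrite -[LHS](cat_take_drop (size u)); congr (_ ++ _).
apply: (@eq_from_nth _ (c 0)); rewrite size_takel // => i ilt.
move: (congr1 (fun f : cantor n => f i) E); rewrite /wcat.
rewrite ilt (leq_trans ilt suv) nth_take // => ->.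
by apply: set_nth_default; apply: leq_trans suv.
Qed.

Lemma wcat_eq_size u v c d :
  size u = size v -> wcat u c = wcat v d -> u = v /\ c = d.
Proof.
move=> suv E; suff uv : u = v by split=> //; apply: (@wcat_inj u); rewrite E uv.
by rewrite -(mkseq_wcat_size u c) E suv mkseq_wcat_size.
Qed.

Lemma mkseq_le d e m k :
  m <= k -> mkseq d k = mkseq e k -> mkseq d m = mkseq e m.
Proof.
move=> mk E; apply: (@eq_from_nth _ (d 0)); rewrite ?size_mkseq // => i im.
have ik := leq_trans im mk.
by rewrite !nth_mkseq // -(nth_mkseq (d 0) d ik) E nth_mkseq.
Qed.

Lemma wcat_mkseq d m : d = wcat (mkseq d m) (fun i => d (m + i)).
Proof.
rewrite {1}(@cone_wcatE (mkseq d m) d) ?size_mkseq //.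
by rewrite /cone /= size_mkseq.
Qed.

Lemma mkseq_add d i j :
  mkseq d (i + j) = mkseq d i ++ mkseq (fun k => d (i + k)) j.
Proof.
elim: j => [|j IH]; first by rewrite addn0 cats0.
by rewrite addnS !mkseqS -rcons_cat IH.
Qed.

Lemma mkseq_wcat u c k : mkseq (wcat u c) (size u + k) = u ++ mkseq c k.
Proof.
rewrite mkseq_add mkseq_wcat_size; congr (_ ++ _); apply: eq_mkseq => i.
by rewrite /wcat ltnNge leq_addr addKn.
Qed.

Lemma cone_mkseq d e m : cone (mkseq d m) e <-> mkseq e m = mkseq d m.
Proof. by rewrite /cone /= size_mkseq; split. Qed.

Lemma nbhs_contains_cone d (A : set (cantor n)) :
  nbhs d A -> exists m, cone (mkseq d m) `<=` A.
Proof.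
pose F : set_system (cantor n) := [set A | exists m, cone (mkseq d m) `<=` A].
have FF : Filter F.
  split; first by exists 0.
  - move=> P R [i Pi] [j Rj]; exists (maxn i j) => e.
    move=> /cone_mkseq E.
    by split; [apply: Pi|apply: Rj]; apply/cone_mkseq;
      apply: mkseq_le E; rewrite ?leq_maxl ?leq_maxr.
  - by move=> P R PR [i Pi]; exists i => e /Pi /PR.
suff : F --> d by apply.
apply/cvg_sup => i B; rewrite nbhsE => -[C [[D oD <-] Dd] CB].
exists i.+1 => e /cone_mkseq E; apply: CB.
suff Ei : e i = d i by move: Dd => /=; rewrite Ei.
by rewrite -(nth_mkseq (d 0) e (ltnSn i)) E nth_mkseq.
Qed.

Lemma nbhs_cone d m : nbhs d (cone (mkseq d m)).
Proof.
elim: m => [|m IH]; first by apply: filterS filterT.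
have H : nbhs d [set e : cantor n | e m = d m].
  have := @proj_continuous nat (fun=> discrete_topology 'I_n) m d.
  by move=> /(_ [set x | x = d m] (discrete_set1 _)).
apply: filterS (filterI IH H) => e [] /cone_mkseq E1 E2; apply/cone_mkseq.
by rewrite !mkseqS E1 E2.
Qed.
End Words.

(** * Compactness of Cantor space *)

Section Compactness.
Variable n : nat.
Implicit Types (u v w : word n) (c d e : cantor n).

(** A property monotone in its bound that holds eventually at each element of a
    finite list holds at all of them from a common bound on. *)
Lemma eventually_all (T : eqType) (s : seq T) (P : T -> nat -> Prop) :
  (forall x i j, i <= j -> P x i -> P x j) ->
  (forall x, x \in s -> exists j, P x j) ->
  exists k, forall x, x \in s -> P x k.
Proof.
move=> mon; elim: s => [|y s IH] H; first by exists 0.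
have [x xs|k Hk] := IH; first by apply: H; rewrite inE xs orbT.
have [j Hj] := H y (mem_head _ _).
exists (maxn j k) => x; rewrite inE => /predU1P[->|xs].
  by apply: mon Hj; rewrite leq_maxl.
by apply: mon (Hk _ xs); rewrite leq_maxr.
Qed.

(** Bar induction on the tree of words: this is the compactness of Cantor space
    in combinatorial form. If it failed, one could follow an infinite branch of
    words violating [P]. *)
Lemma fan_theorem (P : word n -> Prop) :
  (forall u, (forall x, P (rcons u x)) -> P u) ->
  (forall d, exists m, P (mkseq d m)) -> P [::].
Proof.
move=> hered bar; apply: contrapT => P0.
have next u : ~ P u -> exists x, ~ P (rcons u x).
  by move=> nPu; apply/existsNP => /hered.
have [x0 _] := next _ P0.
pose step u := rcons u (xget x0 [set x | ~ P (rcons u x)]).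
have stepP u : ~ P u -> ~ P (step u) by move=> /next ex; apply: (xgetPex x0 ex).
pose branch m := iter m step [::].
have nP m : ~ P (branch m) by elim: m => //= m; apply: stepP.
pose d : cantor n := fun m => xget x0 [set x | ~ P (rcons (branch m) x)].
have Ed m : mkseq d m = branch m by elim: m => //= m IH; rewrite mkseqS IH.
by have [m] := bar d; rewrite Ed; apply: nP.
Qed.

Lemma continuous_uniform (f : cantor n -> cantor n) : continuous f ->
  forall m, exists k, forall d e, mkseq d k = mkseq e k ->
    mkseq (f d) m = mkseq (f e) m.
Proof.
move=> fC m.
pose good u k := forall d e, mkseq d k = mkseq e k ->
  cone u d -> cone u e -> mkseq (f d) m = mkseq (f e) m.
suff [k H] : exists k, good [::] k by exists k => d e /H; apply.
apply: (fan_theorem (P := fun u => exists k, good u k)).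
  move=> u H.
  have [||k Hk] := @eventually_all 'I_n (enum 'I_n) (fun x => good (rcons u x)).
  - move=> x i j ij Hi d e E; exact: Hi (mkseq_le ij E).
  - by move=> x _; exact: H.
  exists (maxn k (size u).+1) => d e E ud ue.
  have Es : mkseq d (size u).+1 = mkseq e (size u).+1.
    by apply: mkseq_le E; rewrite leq_maxr.
  apply: (Hk (d (size u)) (mem_enum _ _)).
  - by apply: mkseq_le E; rewrite leq_maxl.
  - by rewrite /cone /= size_rcons mkseqS -ud.
  - by rewrite /cone /= size_rcons -Es mkseqS -ud.
move=> d.
have [k Hk] := nbhs_contains_cone (fC d _ (nbhs_cone (f d) m)).
exists k, 0 => e1 e2 _ /Hk /cone_mkseq -> /Hk /cone_mkseq -> //.
Qed.

End Compactness.

(** * Homeomorphisms *)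

Section Homeo.
Variable X : topologicalType.
Implicit Types f g : X -> X.

Lemma homeomorphism_id : homeomorphism (@idfun X).
Proof. by split; [|exists idfun; split] => // x; exact: cvg_id. Qed.

Lemma homeomorphism_comp f g :
  homeomorphism f -> homeomorphism g -> homeomorphism (g \o f).
Proof.
move=> [fC [f' [ff' f'f f'C]]] [gC [g' [gg' g'g g'C]]]; split.
  by move=> x; exact: (continuous_comp (fC x) (gC _)).
exists (f' \o g'); split.
- exact: can_comp.
- exact: can_comp.
- by move=> x; exact: (continuous_comp (g'C x) (f'C _)).
Qed.

Lemma homeomorphism_inv f g :
  homeomorphism f -> cancel f g -> cancel g f -> homeomorphism g.
Proof.
move=> [fC [f' [ff' f'f f'C]]] fg gf.
have E : g = f' by apply/funext => x; rewrite -{1}(f'f x) fg.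
by split; [rewrite E | exists f].
Qed.
End Homeo.

(** * The Thompson group *)

Section Thompson.
Variable n : nat.
Hypothesis n2 : 2 <= n.
Implicit Types (u v w : word n) (c d e : cantor n).

(** As the alphabet has two letters, cones are not reduced to points; hence a
    cone determines its word ([wcat_eq]). *)
Lemma cantor_apart c : exists d, d 0 <> c 0.
Proof.
have [x Ex] : exists x : 'I_n, x <> c 0.
  have n0 : 0 < n by apply: ltn_trans n2.
  have [E|NE] := eqVneq (c 0 : nat) 0.
    by exists (Ordinal n2) => E'; move: E; rewrite -E'.
  by exists (Ordinal n0) => E'; move: NE; rewrite -E'.
by exists (fun=> x).
Qed.

(** The constant sequence 1, which only serves as a point of Cantor space. *)
Definition cantor0 : cantor n := fun=> Ordinal n2.

Lemma wcat_all_nil u : (forall c, exists d, c = wcat u d) -> u = [::].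
Proof.
case: u => // x u H; have [c] := cantor_apart (wcat (x :: u) cantor0).
by have [d ->] := H c.
Qed.

(** [u] is a prefix of [v] as soon as the cone of [v] lies in that of [u]. *)
Lemma cone_sub_prefix u v :
  (forall c, cone u (wcat v c)) -> exists w, v = u ++ w.
Proof.
move=> H.
have [c E] := cone_ex (H cantor0).
have [suv|svu] := leqP (size u) (size v).
  by have /prefixP[w ->] := wcat_eq_prefix suv (esym E); exists w.
have /prefixP[w Eu] := wcat_eq_prefix (ltnW svu) E.
suff w0 : w = [::] by exists [::]; rewrite Eu w0 !cats0.
apply: wcat_all_nil => d; have [e] := cone_ex (H d).
by rewrite Eu wcat_cat => /wcat_inj ->; exists e.
Qed.

Lemma wcat_eq u v : (forall c, wcat u c = wcat v c) -> u = v.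
Proof.
move=> H; wlog suv : u v H / size u <= size v.
  by move=> W; have [/W->|/ltnW /W->] := leqP (size u) (size v).
have [w Ev] : exists w, v = u ++ w.
  by apply: cone_sub_prefix => c; rewrite -H; exact: cone_wcat.
rewrite Ev; suff -> : w = [::] by rewrite cats0.
apply: wcat_all_nil => c; exists c; apply: (@wcat_inj _ u).
by rewrite -wcat_cat -Ev.
Qed.

(** [v] acts by prefix replacement on each cone of depth [m]. *)
Definition prefix_replacing m (v : cantor n -> cantor n) :=
  forall a, size a = m -> exists b, forall c, v (wcat a c) = wcat b c.

(** The replacement words form a maximal antichain because [v] is a bijection;
    conversely the longest word of the antichain gives the depth. *)
Lemma thompsonP (v : cantor n -> cantor n) :
  thompson v <-> homeomorphism v /\ exists m, prefix_replacing m v.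
Proof.
split=> [[hv [l [a [b [[_ _ maxa] _ H]]]]]|[hv [m H]]]; split=> //.
  exists (\max_(i < l) size (tnth a i)) => w sw.
  have [u ua /orP uw] := maxa w; have /tnthP[i Ei] := ua.
  have szu : size u <= size w.
    by rewrite sw Ei; exact: (leq_bigmax (F := fun i : 'I_l => size (tnth a i))).
  have /prefixP[w' Ew] : prefix u w.
    case: uw => // /prefixP[t Et]; move: szu; rewrite Et size_cat.
    rewrite -{2}[size w]addn0 leq_add2l leqn0 size_eq0 => /eqP->.
    by rewrite cats0 prefix_refl.
  by exists (tnth b i ++ w') => c; rewrite Ew Ei !wcat_cat H.
have [v' [vv' v'v _]] := hv.2.
have vinj := can_inj vv'.
pose r (a : m.-tuple 'I_n) : word n :=
  xget [::] [set b | forall c, v (wcat a c) = wcat b c].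
have rP (a : m.-tuple 'I_n) c : v (wcat a c) = wcat (r a) c.
  by move: c; apply: (xgetPex [::] (H a (size_tuple a))).
have rpre a a' : prefix (r a) (r a') -> a = a'.
  move=> /prefixP[t Et].
  have E : v (wcat a' cantor0) = v (wcat a (wcat t cantor0)).
    by rewrite !rP Et wcat_cat.
  by have [|/val_inj] := wcat_eq_size _ (vinj _ _ E); rewrite ?size_tuple.
have rinj : injective r by move=> a a' E; apply: rpre; rewrite E prefix_refl.
exists #|{: m.-tuple 'I_n}|, (map_tuple val (enum_tuple {: m.-tuple 'I_n})),
  (map_tuple r (enum_tuple {: m.-tuple 'I_n})).
split.
- split=> /=.
  + by rewrite map_inj_uniq ?enum_uniq //; exact: val_inj.
  + move=> _ _ /mapP[a _ ->] /mapP[b _ ->] /prefixP[t Et].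
    have: size (a ++ t) = size b by rewrite Et.
    rewrite size_cat !size_tuple -{2}[m]addn0 => /addnI/eqP.
    rewrite size_eq0 => /eqP t0.
    by rewrite Et t0 cats0.
  + move=> w; pose a := [tuple (wcat w cantor0) i | i < m].
    have Ea : wcat w cantor0 = wcat a (fun i => wcat w cantor0 (m + i)).
      rewrite {1}(wcat_mkseq (wcat w cantor0) m); congr wcat.
      by rewrite /mkseq -val_enum_ord -map_comp.
    exists (val a); first by apply: map_f; rewrite mem_enum.
    have [s|/ltnW s] := leqP (size a) (size w).
      by rewrite (wcat_eq_prefix s (esym Ea)).
    by rewrite (wcat_eq_prefix s Ea) orbT.
- split=> /=.
  + by rewrite map_inj_uniq ?enum_uniq.
  + by move=> _ _ /mapP[a _ ->] /mapP[b _ ->] /rpre ->.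
  + move=> w; pose d := v' (wcat w cantor0).
    pose a := [tuple d i | i < m].
    have Ea : wcat w cantor0 = wcat (r a) (fun i => d (m + i)).
      rewrite -rP -[LHS]v'v; congr v; rewrite -/d {1}(wcat_mkseq d m).
      congr wcat.
      by rewrite /mkseq -val_enum_ord -map_comp.
    exists (r a); first by apply: map_f; rewrite mem_enum.
    have [s|/ltnW s] := leqP (size (r a)) (size w).
      by rewrite (wcat_eq_prefix s (esym Ea)).
    by rewrite (wcat_eq_prefix s Ea) orbT.
- by move=> i c; rewrite !tnth_map rP.
Qed.

Lemma prefix_replacing_le m k (v : cantor n -> cantor n) :
  m <= k -> prefix_replacing m v -> prefix_replacing k v.
Proof.
move=> mk H a sa; have [|b Hb] := H (take m a); first by rewrite size_takel ?sa.
exists (b ++ drop m a) => c.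
by rewrite -{1}(cat_take_drop m a) !wcat_cat Hb.
Qed.

Lemma thompson_id : @thompson n idfun.
Proof.
apply/thompsonP; split; first exact: homeomorphism_id.
by exists 0 => a _; exists a.
Qed.

Lemma thompson_comp (f g : cantor n -> cantor n) :
  thompson f -> thompson g -> thompson (g \o f).
Proof.
move=> /thompsonP[hf [i Hf]] /thompsonP[hg [j Hg]]; apply/thompsonP.
split; first exact: homeomorphism_comp.
exists (i + j) => a sa.
have [|b Hb] := Hf (take i a); first by rewrite size_takel // sa leq_addr.
have [|b' Hb'] := prefix_replacing_le _ Hg (erefl (size (b ++ drop i a))).
  by rewrite size_cat size_drop sa addKn leq_addl.
by exists b' => c /=; rewrite -{1}(cat_take_drop i a) wcat_cat Hb -wcat_cat Hb'.
Qed.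

Lemma thompson_inv (f g : cantor n -> cantor n) :
  thompson f -> cancel f g -> cancel g f -> thompson g.
Proof.
move=> [hf [l [a [b [ma mb H]]]]] fg gf; split.
  exact: homeomorphism_inv fg gf.
by exists l, b, a; split=> // i c; rewrite -H fg.
Qed.

Lemma subgroup_conjugate_thompson (h : cantor n -> cantor n) :
  homeomorphism h -> subgroup (conjugate h (@thompson n)).
Proof.
move=> hh; have [hC [h' [hh' h'h h'C]]] := hh.
split.
- move=> _ [v [t' [Tv tt' t't ->]]] /=.
  apply: homeomorphism_comp; first exact: homeomorphism_inv tt' t't.
  by apply: homeomorphism_comp => //; case: Tv.
- exists idfun, h'; split=> //; first exact: thompson_id.
  by apply/funext => x /=; rewrite h'h.
- move=> f g [v [t' [Tv tt' t't ->]]] [w [t2 [Tw tt2 t2t ->]]].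
  exists (w \o v), t'; split=> //; first exact: thompson_comp.
  apply/funext => x /=; rewrite tt2 //.
- move=> f g [v [t' [Tv tt' t't ->]]] fg gf.
  exists (t' \o g \o h), t'; split=> //.
    apply: (thompson_inv Tv) => x /=.
      by have := fg (h x); rewrite /= tt' => ->; rewrite tt'.
    by apply: (can_inj tt'); exact: gf (h x).
  by apply/funext => x /=; rewrite !t't.
Qed.

End Thompson.

(** * The map induced by a transducer *)

Section Tmap.
Variables (n : nat) (Q : Type) (T : transducer n Q).
Implicit Types (u v w : word n) (c d e : cantor n) (q : Q).

Lemma transw_cat u v q : transw T (u ++ v) q = transw T v (transw T u q).
Proof. by elim: u q => //= x u IH q. Qed.

Lemma outputw_cat u v q :
  outputw T (u ++ v) q = outputw T u q ++ outputw T v (transw T u q).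
Proof. by elim: u q => //= x u IH q; rewrite IH catA. Qed.

Hypothesis hinf : infinite_outputs T.

(** The infinite word whose letter [i] is read off the output on any prefix whose
    output is long enough meets the specification of [tmap]. *)
Lemma tmap_cone q d m : cone (outputw T (mkseq d m) q) (tmap T q d).
Proof.
pose P := [set e : cantor n | forall m, cone (outputw T (mkseq d m) q) e].
suff ex : exists e, P e by exact: (xgetPex d ex) m.
pose out i := outputw T (mkseq d i) q.
have pre i j : i <= j -> exists t, out j = out i ++ t.
  by move=> /subnKC <-; rewrite /out mkseq_add outputw_cat; eexists.
pose len i := xget 0 [set m | i < size (out m)].
have lenP i : i < size (out (len i)) by apply: (xgetPex 0 (hinf q d i.+1)).
exists (fun i => nth (d 0) (out (len i)) i) => k.
rewrite /cone /= -/(out k).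
apply: (@eq_from_nth _ (d 0)); rewrite ?size_mkseq // => i ik.
rewrite nth_mkseq //.
have [le|/ltnW le] := leqP k (len i).
  by have [t ->] := pre _ _ le; rewrite nth_cat ik.
by have [t ->] := pre _ _ le; rewrite nth_cat lenP.
Qed.

Lemma tmap_unique q d e :
  (forall m, cone (outputw T (mkseq d m) q) e) -> tmap T q d = e.
Proof.
move=> He; apply/funext => i.
have [m lim] := hinf q d i.+1.
have := tmap_cone q d m; have := He m; rewrite /cone /= => {1}-> E.
by rewrite -(nth_mkseq (d 0) (tmap T q d) lim) -E nth_mkseq.
Qed.

Lemma tmap_wcat u q c :
  tmap T q (wcat u c) = wcat (outputw T u q) (tmap T (transw T u q) c).
Proof.
apply: tmap_unique => m.
have /cone_wcatE E := tmap_cone (transw T u q) c m.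
suff [t Et] : exists t, outputw T (mkseq (wcat u c) (size u + m)) q =
                        outputw T (mkseq (wcat u c) m) q ++ t.
  move: Et; rewrite mkseq_wcat outputw_cat => Et.
  by rewrite E -wcat_cat Et wcat_cat; exact: cone_wcat.
by rewrite addnC mkseq_add outputw_cat; eexists.
Qed.

End Tmap.

(** * Longest common prefixes *)

Section Lcp.
Variable n : nat.
Implicit Types (u v w : word n) (c d e : cantor n) (P : set (cantor n)).

(** [u] is the longest common prefix of [P], and [P] has two elements that differ
    just after [u]. Every [P] with at least two elements has such a [u]. *)
Definition is_lcp P u :=
  P `<=` cone u /\ exists d e, [/\ P d, P e & d (size u) <> e (size u)].

Lemma is_lcp_max P u v : is_lcp P u -> P `<=` cone v -> size v <= size u.
Proof.
move=> [_ [d [e [Pd Pe ne]]]] Pv; rewrite leqNgt; apply/negP => lt; apply: ne.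
by rewrite -(nth_mkseq (d 0) d lt) -(nth_mkseq (d 0) e lt) -(Pv _ Pd) -(Pv _ Pe).
Qed.

Lemma lcp_unique P u : is_lcp P u -> lcp P = u.
Proof.
move=> Pu; have [Pc [d [_ [Pd _ _]]]] := Pu.
apply: xget_unique => [|v [Pv maxv]].
  by split=> // v; exact: is_lcp_max Pu.
have E : size v = size u.
  by apply/eqP; rewrite eqn_leq (is_lcp_max Pu Pv) (maxv _ Pc).
by rewrite (Pv _ Pd) (Pc _ Pd) E.
Qed.

Lemma lcpP P d e : P d -> P e -> d <> e -> is_lcp P (lcp P).
Proof.
move=> Pd Pe ne; suff [u Pu] : exists u, is_lcp P u by rewrite (lcp_unique Pu).
have [i di] : exists i, d i <> e i.
  by apply/existsNP => E; apply: ne; apply/funext.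
pose split i := `[< exists d' e', [/\ P d', P e' & d' i <> e' i] >].
have ex : exists i, split i by exists i; apply/asboolP; exists d, e.
case: (ex_minnP ex) => m /asboolP[d' [e' [Pd' Pe' ne']]] minm.
exists (mkseq d m); split; last by exists d', e'; rewrite size_mkseq.
move=> c Pc; apply/cone_mkseq.
apply: (@eq_from_nth _ (d 0)); rewrite ?size_mkseq // => j jm.
rewrite !nth_mkseq //; apply: contrapT => nej.
have := minm j; rewrite leqNgt jm => /(_ _)/notF [].
by apply/asboolP; exists c, d.
Qed.

Lemma is_lcp_wcat P u v : is_lcp P v -> is_lcp (wcat u @` P) (u ++ v).
Proof.
move=> [Pv [d [e [Pd Pe ne]]]]; split.
  by move=> _ [c /Pv/cone_wcatE -> <-]; rewrite -wcat_cat; exact: cone_wcat.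
exists (wcat u d), (wcat u e); split; [by exists d | by exists e |].
by rewrite /wcat size_cat ltnNge leq_addr addKn.
Qed.

End Lcp.

(** * The collapsing procedure *)

Section Collapse.
Variables (n : nat) (A : automaton n).
Implicit Types (w : word n) (p q : A).

Lemma collapse_class_eq (B : automaton n) (p q : B) :
  collapse_class p = collapse_class q <-> forall i, atrans i p = atrans i q.
Proof.
split=> [/eqmodP/forallP H i|H]; first exact/eqP.
by apply/eqmodP/forallP => i; apply/eqP.
Qed.

Lemma atrans_represented k i q :
  atrans i (represented k q) = represented k (atrans i q).
Proof.
elim: k => // k IH.
exact: etrans (atrans_collapse_class i (represented k q)) (congr1 _ IH).
Qed.

(** Each collapsing step looks one letter further. *)
Lemma represented_eq k p q : represented k p = represented k q <->
  forall w, size w = k -> atransw w p = atransw w q.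
Proof.
elim: k p q => [|k IH] p q; first by split=> [E [] //|H]; exact: (H [::]).
split=> [/collapse_class_eq H [//|x w] [sw]|H] /=.
  by apply: (IH _ _).1 sw; rewrite -!atrans_represented.
apply/collapse_class_eq => i; rewrite !atrans_represented; apply/IH => w sw.
by apply: (H (i :: w)); rewrite /= sw.
Qed.

Lemma represented_surj k (c : iter k (@collapse n) A) :
  exists q : A, represented k q = c.
Proof.
elim: k c => [c|k IH c]; first by exists c.
by have [q E] := IH (repr c); exists q; rewrite /= E; exact: reprK.
Qed.

Lemma represented_le j k p q :
  j <= k -> represented j p = represented j q ->
  represented k p = represented k q.
Proof.
move=> jk /represented_eq H; apply/represented_eq => w sw.
have aw v v' s : atransw (v ++ v') s = atransw v' (atransw v s) :> A.
  by elim: v s => //= x v IHv s.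
by rewrite -(cat_take_drop j w) !aw H // size_takel // sw.
Qed.

(** For a finite automaton the collapsing procedure stabilizes: [k] is a bound for
    the stages at which pairs of states get identified, if ever. *)
Lemma collapsed_exists (s : seq A) : (forall q, q \in s) ->
  exists k, collapsed (iter k (@collapse n) A) /\
    forall j p q, represented j p = represented j q ->
      represented k p = represented k q.
Proof.
move=> sA.
pose P (pq : A * A) k := forall j,
  represented j pq.1 = represented j pq.2 ->
  represented k pq.1 = represented k pq.2.
have [||k Hk] := @eventually_all _ [seq (p, q) | p <- s, q <- s] P.
- by move=> [p q] i j ij Hi j' /Hi; exact: represented_le.
- move=> [p q] _.
  have [[j E]|NE] := pselect (exists j, represented j p = represented j q).
    by exists j.
  by exists 0 => j E; case: NE; exists j.
have stable j p q : represented j p = represented j q ->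
    represented k p = represented k q.
  by apply: (Hk (p, q)); apply: allpairs_f.
exists k; split=> // c1 c2.
have [p <-] := represented_surj c1; have [q <-] := represented_surj c2.
by move=> H; apply: (stable k.+1); apply/collapse_class_eq.
Qed.

End Collapse.

(** * States of the inverse transducer *)

Section Inverse.
Variables (n : nat) (n2 : 2 <= n) (Q : finType) (T : transducer n Q) (q0 : Q).
Hypothesis hinf : infinite_outputs T.
Let h := tmap T q0.
Variable h' : cantor n -> cantor n.
Hypotheses (hC : continuous h) (h'C : continuous h').
Hypotheses (hh' : cancel h h') (h'h : cancel h' h).
Implicit Types (a b u w : word n) (c d e y : cantor n) (q : Q).

(* [L a] is the longest common prefix of the preimage of the cone of [a]. *)
Let L a := lpre T q0 a.
(* The state of the inverse transducer after reading [a]. *)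
Let state a := transw (inverse_pairs T) a ([::], q0).

Lemma preimage_cone a c : (h @^-1` cone a) (h' (wcat a c)).
Proof. by rewrite /preimage /= h'h; exact: cone_wcat. Qed.

Lemma lpre_is_lcp a : is_lcp (h @^-1` cone a) (L a).
Proof.
have [c ne] := cantor_apart n2 (cantor0 n2).
apply: (lcpP (preimage_cone a c) (preimage_cone a (cantor0 n2))).
by move=> /(can_inj h'h)/wcat_inj E; apply: ne; rewrite E.
Qed.

(** If every preimage of the cone of [a] starts with [u], then [lambda u] is a
    prefix of [a], and the remainder [w] of [a] describes the preimages below
    [u] in terms of the state reached after [u]. *)
Lemma output_split a u : h @^-1` cone a `<=` cone u ->
  exists2 w, a = outputw T u q0 ++ w &
    forall y c, h (wcat u y) = wcat a c <->
                tmap T (transw T u q0) y = wcat w c.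
Proof.
move=> au; have [w Ea] : exists w, a = outputw T u q0 ++ w.
  apply: (cone_sub_prefix n2) => c.
  have [y Ey] := cone_ex (au _ (preimage_cone a c)).
  by rewrite -[wcat a c]h'h Ey /h tmap_wcat //; exact: cone_wcat.
exists w => // y c; rewrite /h tmap_wcat // Ea wcat_cat.
by split=> [/wcat_inj|->].
Qed.

(** By induction on [a]: if [w] and [q] are the components of the state after
    [a], then [L (a x)] is [L a] followed by the longest common prefix of the
    preimage under [T_q] of the cone of [w x]. *)
Lemma state_lpre a :
  state a = (drop (size (outputw T (L a) q0)) a, transw T (L a) q0).
Proof.
rewrite /state; elim/last_ind: a => [|a x IH].
  suff -> : L [::] = [::] by [].
  apply: lcp_unique; split=> //.
  have [c ne] := cantor_apart n2 (cantor0 n2).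
  exists c, (cantor0 n2); split=> //.
rewrite -cats1 transw_cat IH /=; have [La _] := lpre_is_lcp a.
have [w Ea Hw] := output_split La.
have drop_a u z s : a = u ++ w -> drop (size u + s) (a ++ z) = drop s (w ++ z).
  by move=> ->; rewrite -catA addnC -drop_drop drop_size_cat.
have -> : drop (size (outputw T (L a) q0)) a = w.
  by have := drop_a _ [::] 0 Ea; rewrite addn0 !cats0 drop0.
set q := transw T (L a) q0; set L' := lpre T q (rcons w x).
have ax_a : h @^-1` cone (a ++ [:: x]) `<=` h @^-1` cone a.
  by move=> d /cone_ex [c]; rewrite wcat_cat /preimage /= => ->; exact: cone_wcat.
have P d : (h @^-1` cone (a ++ [:: x])) d ->
    exists2 y, d = wcat (L a) y & (tmap T q @^-1` cone (rcons w x)) y.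
  move=> dax; have [y Ey] := cone_ex (La _ (ax_a _ dax)); exists y => //.
  have [c] := cone_ex dax; rewrite Ey wcat_cat => /Hw Ec.
  by rewrite /preimage /= Ec -wcat_cat cats1; exact: cone_wcat.
have L'P : is_lcp (tmap T q @^-1` cone (rcons w x)) L'.
  have [_ [d [e [/P[y -> Py] /P[z -> Pz] ne]]]] := lpre_is_lcp (a ++ [:: x]).
  by apply: (lcpP Py Pz) => E; apply: ne; rewrite E.
have -> : L (a ++ [:: x]) = L a ++ L'.
  apply: lcp_unique; suff -> : h @^-1` cone (a ++ [:: x]) =
    wcat (L a) @` (tmap T q @^-1` cone (rcons w x)) by exact: is_lcp_wcat.
  apply/seteqP; split=> [d /P[y -> Py]|_ [y Py <-]]; first by exists y.
  have [c Ec] := cone_ex Py; rewrite -cats1 wcat_cat in Ec.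
  by move/Hw: Ec; rewrite /preimage /= => ->; rewrite -wcat_cat; exact: cone_wcat.
by rewrite transw_cat outputw_cat size_cat -/q drop_a // cats1.
Qed.

Lemma state_split a w :
  a = outputw T (L a) q0 ++ w -> state a = (w, transw T (L a) q0).
Proof.
rewrite state_lpre; set u := outputw T (L a) q0 => E.
by rewrite {1}E drop_size_cat.
Qed.

Hypothesis hacc : forall q, accessible T q0 q.

(** The words [w] are bounded for each state [q]: fix [u] leading from [q0] to
    [q]. Below [L a] there are preimages that differ in their first letter [y 0];
    put after [u], they give points that differ in the first [size u + 1] letters
    but whose images agree on [lambda u ++ w]. Uniform continuity of the inverse
    of [h] bounds the length of this common prefix. *)
Lemma states_finite :
  exists s : seq (inverse_state T q0), forall p, p \in s.
Proof.
have [||B HB] := @eventually_all Q (enum Q) (fun q m =>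
   forall a, (state a).2 = q -> size (state a).1 <= m).
- by move=> q i j ij H a /H si; exact: leq_trans ij.
- move=> q _; have [u Eu] := hacc q.
  have [M HM] := continuous_uniform h'C (size u).+1.
  exists M => a; have [La [d [e [da ea ne]]]] := lpre_is_lcp a.
  have [w Ea Hw] := output_split La; rewrite (state_split Ea) /= => Eq.
  rewrite leqNgt; apply/negP => lt.
  have [y Ey] := cone_ex (La _ da); have [z Ez] := cone_ex (La _ ea).
  apply: ne; rewrite Ey Ez /wcat !ltnn subnn.
  have [c] := cone_ex da; rewrite Ey => /Hw; rewrite Eq => Ec.
  have [c'] := cone_ex ea; rewrite Ez => /Hw; rewrite Eq => Ec'.
  have tu x : h (wcat u x) = wcat (outputw T u q0) (tmap T q x).
    by rewrite /h tmap_wcat // Eu.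
  have := HM (h (wcat u y)) (h (wcat u z)).
  rewrite !hh' !tu Ec Ec' -!wcat_cat.
  set o := outputw T u q0 ++ w.
  have le : M <= size o by rewrite size_cat (leq_trans (ltnW lt)) ?leq_addl.
  have -> : mkseq (wcat o c) M = mkseq (wcat o c') M.
    by apply: (mkseq_le le); rewrite !mkseq_wcat_size.
  move=> /(_ erefl); rewrite -addn1 !mkseq_wcat => /eqP.
  by rewrite eqseq_cat // eqxx /= => /eqP [].
have [W HW] : exists W : seq (word n), forall w, size w <= B -> w \in W.
  elim: B {HB} => [|B [W HW]].
    by exists [:: [::]] => w; rewrite leqn0 size_eq0 => /eqP->; rewrite inE.
  exists ([::] :: [seq x :: w | x <- enum 'I_n, w <- W]) => -[|x w] //= sw.
  by rewrite inE; apply/orP; right; apply: allpairs_f; rewrite ?mem_enum ?HW.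
exists (pmap insub [seq (w, q) | w <- W, q <- enum Q]) => p.
rewrite mem_pmap_sub /=; have [a Ea] := set_mem (valP p).
rewrite [val p]surjective_pairing; apply: allpairs_f; last by rewrite mem_enum.
by apply: HW; rewrite -Ea; apply: (HB (state a).2); rewrite ?mem_enum.
Qed.

Let A := automaton_of (inverse T q0) (inverse0 T q0).

Lemma atranswE w (p : A) :
  val (atransw w p) = transw (inverse_pairs T) w (val p).
Proof. by elim: w p => //= x w IH p; rewrite IH. Qed.

(** The equivalence in terms of states reached, without the collapsing procedure. *)
Lemma sim_iff_states a b : sim A a b <->
  exists m, forall t, size t = m -> state (a ++ t) = state (b ++ t).
Proof.
have valE t x : val (atransw t (atransw x (astart A))) = state (x ++ t).
  by rewrite !atranswE /state transw_cat.
split=> [[k [_ /represented_eq H]]|[m H]].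
  by exists k => t /H Et; rewrite -!valE Et.
have [s Hs] := states_finite.
have [k [ck Hk]] := collapsed_exists (A := A) Hs.
exists k; split=> //; apply: (Hk m); apply/represented_eq => t st.
by apply: val_inj; rewrite !valE; exact: H.
Qed.

(** Long cones have long common prefixes of their preimages. *)
Lemma preimage_long m : exists M, forall a u, M <= size a ->
  is_lcp (h @^-1` cone a) u -> m <= size u.
Proof.
have [M HM] := continuous_uniform h'C m; exists M => a u Ma Hu.
suff H : h @^-1` cone a `<=` cone (mkseq (h' (wcat a (cantor0 n2))) m).
  by have := is_lcp_max Hu H; rewrite size_mkseq.
move=> d /cone_ex [c Ec]; apply/cone_mkseq; rewrite -[d]hh' Ec.
by apply: HM; apply: (mkseq_le Ma); rewrite !mkseq_wcat_size.
Qed.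

Lemma synchronizing_long k u q q' : synchronizing_at T k -> k <= size u ->
  transw T u q = transw T u q'.
Proof.
move=> [f Hf] ku; have s : size (take k u) == k by rewrite size_takel.
rewrite -(cat_take_drop k u) !transw_cat.
by rewrite (Hf (Tuple s) q) (Hf (Tuple s) q').
Qed.

(** * Conjugates of elements of the Thompson group *)

Section ConjugateSubset.
Variables (k : nat) (v : cantor n -> cantor n) (al be ga : word n).
Hypotheses (ksync : synchronizing_at T k) (kga : k <= size ga).
Hypothesis v_al : forall c, v (wcat al c) = wcat be c.

Lemma conjugate_prefix_replacing a : h @^-1` cone a `<=` cone (al ++ ga) ->
  exists b, forall c, h (v (h' (wcat a c))) = wcat b c.
Proof.
move=> Ha; have [w Ea Hw] := output_split Ha.
exists (outputw T (be ++ ga) q0 ++ w) => c.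
have [y Ey] := cone_ex (Ha _ (preimage_cone a c)).
have /Hw Eyc : h (wcat (al ++ ga) y) = wcat a c by rewrite -Ey h'h.
rewrite Ey wcat_cat v_al -wcat_cat /h tmap_wcat // wcat_cat; congr wcat.
rewrite -Eyc !transw_cat.
by congr (tmap T _ y); exact: synchronizing_long kga.
Qed.

(** The map [v] carries the preimage of the cone of [a] onto that of [b], whence
    [L b = be ++ ga]. So [T] is in the same state [q] after [L a] and [L b]; the
    remainders [w] of [a] and [w'] of [b] agree, as [T_q] sends the same points
    to [w c] and to [w' c]. *)
Lemma conjugate_state a b : (forall c, h (v (h' (wcat a c))) = wcat b c) ->
  L a = al ++ ga -> state a = state b.
Proof.
move=> fab ELa; have [La [d [e [da ea ne]]]] := lpre_is_lcp a.
have vga y : v (wcat (al ++ ga) y) = wcat (be ++ ga) y.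
  by rewrite !wcat_cat v_al.
rewrite ELa in La ne.
have vab y : (h @^-1` cone a) (wcat (al ++ ga) y) ->
    (h @^-1` cone b) (wcat (be ++ ga) y).
  move=> /cone_ex [c Ec]; rewrite /preimage /= -vga -[wcat (al ++ ga) y]hh' Ec fab.
  exact: cone_wcat.
have ELb : L b = be ++ ga.
  apply: lcp_unique; split.
    move=> x /cone_ex [c Ec].
    have -> : x = v (h' (wcat a c)) by rewrite -[LHS]hh' [h x]Ec -fab hh'.
    have [y ->] := cone_ex (La _ (preimage_cone a c)).
    by rewrite vga; exact: cone_wcat.
  have [y Ey] := cone_ex (La _ da); have [z Ez] := cone_ex (La _ ea).
  exists (wcat (be ++ ga) y), (wcat (be ++ ga) z); split.
  - by apply: vab; rewrite -Ey.
  - by apply: vab; rewrite -Ez.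
  - by move: ne; rewrite Ey Ez /wcat !ltnn !subnn.
have [Lb _] := lpre_is_lcp b; rewrite ELb in Lb.
have [w Ea Hw] := output_split La; have [w' Eb Hw'] := output_split Lb.
have Eq : transw T (be ++ ga) q0 = transw T (al ++ ga) q0.
  by rewrite !transw_cat; exact: synchronizing_long kga.
rewrite (state_split (w := w)) ?ELa // (state_split (w := w')) ?ELb //.
rewrite Eq; congr pair; apply: (wcat_eq n2) => c.
have [y Ey] := cone_ex (La _ (preimage_cone a c)).
have Ec : h (wcat (al ++ ga) y) = wcat a c by rewrite -Ey h'h.
have /Hw' Ec' : h (wcat (be ++ ga) y) = wcat b c by rewrite -vga -Ey fab.
by move/Hw: Ec => <-; rewrite -Ec' Eq.
Qed.

End ConjugateSubset.

(** The conjugate preserves the relation itself; no product of elements that do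
    is needed. *)
Lemma conjugate_in_sim v : synchronizing T -> thompson v ->
  thompson (h \o v \o h') /\ preserves (sim A) (h \o v \o h').
Proof.
move=> [k ksync] /(thompsonP n2)[hv [m vm]].
have [M HM] := preimage_long (m + k).
(* Since [L a] has length at least [m + k], cut it after [m] letters. *)
have cut a : M <= size a -> exists al be ga,
    [/\ L a = al ++ ga, k <= size ga & forall c, v (wcat al c) = wcat be c].
  move=> Ma; have sL := HM a _ Ma (lpre_is_lcp a).
  have [|be Hbe] := vm (take m (L a)).
    by rewrite size_takel // (leq_trans (leq_addr k m)).
  exists (take m (L a)), be, (drop m (L a)).
  by rewrite cat_take_drop size_drop leq_subRL // (leq_trans (leq_addr k m)).
have hhomeo : homeomorphism h by split=> //; exists h'.
split.
  apply/(thompsonP n2); split.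
    apply: (homeomorphism_comp _ hhomeo); apply: (homeomorphism_comp _ hv).
    exact: (homeomorphism_inv hhomeo hh' h'h).
  exists M => a sa; have [|al [be [ga [ELa kga Hv]]]] := cut a.
    by rewrite sa.
  apply: (conjugate_prefix_replacing ksync kga Hv); rewrite -ELa.
  by case: (lpre_is_lcp a).
move=> a b _ _ fab; apply/sim_iff_states; exists M => t st.
have [|al [be [ga [ELa kga Hv]]]] := cut (a ++ t).
  by rewrite size_cat st leq_addl.
apply: (conjugate_state ksync kga Hv) => // c.
by rewrite !wcat_cat; exact: fab.
Qed.

(** * Elements preserving the relation *)

Lemma sim_in_conjugate v : thompson v -> preserves (sim A) v ->
  thompson (h' \o v \o h).
Proof.
move=> /(thompsonP n2)[hv [m vm]] pv.
(* One more letter makes both the word and its replacement non-empty. *)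
have vm1 a : size a = m.+1 -> exists2 b, b != [::] &
    forall c, v (wcat a c) = wcat b c.
  case/lastP: a => // a x; rewrite size_rcons => -[/vm [b Hb]].
  exists (rcons b x); first by rewrite -size_eq0 size_rcons.
  by move=> c; rewrite -!cats1 !wcat_cat.
have [||K HK] := @eventually_all _ (enum {: m.+1.-tuple 'I_n})
    (fun (a : m.+1.-tuple 'I_n) j =>
    forall b, (forall c, v (wcat a c) = wcat b c) ->
    forall t, size t = j -> state (a ++ t) = state (b ++ t)).
- move=> a i j ij H b ab t st; rewrite -(cat_take_drop i t) !catA.
  rewrite /state !(transw_cat _ (_ ++ _)); congr transw.
  by apply: H => //; rewrite size_takel // st.
- move=> a _; have [b b0 Hb] := vm1 a (size_tuple a).
  have [|j Hj] := (sim_iff_states a b).1.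
    by apply: pv => //; rewrite -size_eq0 size_tuple.
  exists j => b' Hb'; suff -> : b' = b by [].
  by apply: (wcat_eq n2) => c; rewrite -Hb.
(* At depth [m.+1 + K] the words [a] and [b] lead to the very same state. *)
have vst a : size a = m.+1 + K -> exists2 b, state a = state b &
    forall c, v (wcat a c) = wcat b c.
  move=> sa; have sz : size (take m.+1 a) == m.+1.
    by rewrite size_takel // sa leq_addr.
  have [b _ Hb] := vm1 _ (eqP sz); exists (b ++ drop m.+1 a).
    rewrite -{1}(cat_take_drop m.+1 a).
    by apply: (HK (Tuple sz)); rewrite ?mem_enum // size_drop sa addKn.
  by move=> c; rewrite -{1}(cat_take_drop m.+1 a) !wcat_cat Hb.
(* The image of the cone of a word [g] of length [N] lies in a single cone [a]
   of depth [m.+1 + K]; in particular [L a] is a prefix of [g]. *)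
have [N HN] := continuous_uniform hC (m.+1 + K).
have hhomeo : homeomorphism h by split=> //; exists h'.
apply/(thompsonP n2); split.
  apply: (homeomorphism_comp hhomeo); apply: (homeomorphism_comp hv).
  exact: (homeomorphism_inv hhomeo hh' h'h).
exists N => g sg.
pose a := mkseq (h (wcat g (cantor0 n2))) (m.+1 + K).
have sa : size a == m.+1 + K by rewrite size_mkseq.
have [La _] := lpre_is_lcp a.
have ga c : (h @^-1` cone a) (wcat g c).
  apply/cone_mkseq; apply: HN.
  have /mkseq_le le : N <= size g by rewrite sg.
  by apply: le; rewrite !mkseq_wcat_size.
have [r Eg] : exists r, g = L a ++ r.
  by apply: (cone_sub_prefix n2) => c; exact: La.
have [b Eab Hb] := vst a (eqP sa).
have [Lb _] := lpre_is_lcp b.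
have [w Ea Hw] := output_split La; have [w' Eb Hw'] := output_split Lb.
move: Eab; rewrite (state_split Ea) (state_split Eb) => -[Ew Eq].
exists (L b ++ r) => c /=.
have [z Ez] := cone_ex (ga c); rewrite [h _]Ez Hb wcat_cat.
rewrite -[RHS]hh'; congr h'; apply/esym/Hw'; rewrite -Ew -Eq.
by apply/Hw; rewrite -wcat_cat -Eg.
Qed.

End Inverse.

Theorem theorem1p1 (n : nat) (hn : (2 <= n)%N)
  (Q : finType) (T : transducer n Q) (q0 : Q)
  (hinf : infinite_outputs T)
  (hhomeo : homeomorphism (tmap T q0))
  (hacc : forall q : Q, accessible T q0 q)
  (hsync : one_way_synchronizing T q0) :
  conjugate (tmap T q0) (@thompson n)
  = thompson_sim (sim (automaton_of (inverse T q0) (inverse0 T q0))).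
Proof.
have [hC [h' [hh' h'h h'C]]] := hhomeo; have [Tsync _] := hsync.
apply/seteqP; split=> [_ [v [t' [Tv tt' t't ->]]]|].
  have -> : t' = h' by apply/funext => x; rewrite -{1}(h'h x) tt'.
  apply: sub_gen_smallest.
  exact: (conjugate_in_sim hn hinf hC h'C hh' h'h hacc Tsync Tv).
apply: smallest_sub; first exact: subgroup_conjugate_thompson.
move=> v [Tv pv]; exists (h' \o v \o tmap T q0), h'; split=> //.
  exact: (sim_in_conjugate hn hinf hC h'C hh' h'h hacc Tv pv).
by apply/funext => x /=; rewrite !h'h.
Qed.
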